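(* Let $\mathcal{H}$ be the space of all triples $(\ell_1,\ell_2,\ell_3)$ of projective lines in $\mathbb{RP}^3$ such that any line in the triple intersects the two others at distinct points. Then $\mathcal{H}$ is homotopy equivalent to the real complete flag variety $\mathrm{Flag}(\mathbb{R}^4)$.
   Context: Triples are ordered. The condition on a triple means that any two of the three lines are distinct and intersect, and the point where a line of the triple meets one of the other two differs from the point where it meets the remaining one. Projective lines in $\mathbb{RP}^3$ correspond to $2$-dimensional linear subspaces of $\mathbb{R}^4$, and $\mathcal{H}$ carries the subspace topology from the triple product of the Grassmannian of $2$-dimensional subspaces of $\mathbb{R}^4$. $\mathrm{Flag}(\mathbb{R}^n)$ denotes the variety (with its usual real topology) of complete flags in $\mathbb{R}^n$, i.e. sequences of linear subspaces $0=V_0\subset V_1\subset\cdots\subset V_n=\mathbb{R}^n$ with $\dim V_i=i$ for all $i$. *)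

(* Defs.v *)
From HB Require Import structures.
From mathcomp Require Import all_boot all_order all_algebra.
From mathcomp Require Import all_classical all_reals all_analysis.

Set Implicit Arguments.
Unset Strict Implicit.
Unset Printing Implicit Defensive.

Import Order.TTheory GRing.Theory Num.Theory.
Import numFieldNormedType.Exports.

Local Open Scope classical_set_scope.
Local Open Scope ring_scope.

Section Grassmannian.
Variables (R : realType) (k n : nat).

Definition Gr : Type := {U : {vspace 'rV[R]_n} | \dim U == k}.

Definition Gr_vspace (U : Gr) : {vspace 'rV[R]_n} := val U.

Definition rows (A : 'M[R]_(k, n)) : k.-tuple 'rV[R]_n := [tuple row i A | i < k].

Definition frames : set 'M[R]_(k, n) := [set A | free (rows A)].

Lemma dim_frame (A : frames) : \dim <<rows (val A)>>%VS == k.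
Proof. by case: A => A /= /set_mem /eqP ->; rewrite size_tuple. Qed.

Definition frame_span (A : frames) : Gr := Sub <<rows (val A)>>%VS (dim_frame A).

(* Gr carries the quotient (final) topology for frame_span, where frames has
   the subspace topology of 'M[R]_(k, n). *)
Definition Gr_open : set_system Gr := [set O | open (frame_span @^-1` O)].

Lemma Gr_openT : Gr_open setT.
Proof. by rewrite /Gr_open /= preimage_setT; exact: openT. Qed.

Lemma Gr_openI : setI_closed Gr_open.
Proof. by move=> A B oA oB; rewrite /Gr_open /= preimage_setI; exact: openI. Qed.

Lemma Gr_open_bigcup (I : Type) (F : I -> set Gr) :
  (forall i, Gr_open (F i)) -> Gr_open (\bigcup_i F i).
Proof.
move=> oF; rewrite /Gr_open /= preimage_bigcup.
by apply: bigcup_open => i _; exact: oF.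
Qed.

HB.instance Definition _ := Choice.on Gr.
HB.instance Definition _ :=
  isOpenTopological.Build Gr Gr_openT Gr_openI Gr_open_bigcup.

End Grassmannian.

Coercion Gr_vspace : Gr >-> space.

(* The conditions V_0 = 0 and V_n = R^n are the dimension conditions at i = 0
   and i = n.  As for spaceH below, the set, coerced to a type, has the
   subspace topology. *)
Definition Flag (R : realType) (n : nat) :
    set (prod_topology (fun i : 'I_n.+1 => Gr R i n)) :=
  [set V | forall i j : 'I_n.+1, j = i.+1 :> nat -> (V i <= V j)%VS].

Notation proj_line R := (Gr R 2 4).

Definition meet_lines (R : realType) (l m : proj_line R) : Prop :=
  l != m /\ (l :&: m)%VS != 0%VS.

(* For lines satisfying meet_lines l m, the subspace l :&: m of R^4 is the
   1-dimensional subspace representing the intersection point in RP^3. *)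
Definition meets_at_distinct_points (R : realType) (l m n : proj_line R) : Prop :=
  [/\ meet_lines l m, meet_lines l n & (l :&: m)%VS != (l :&: n)%VS].

Definition spaceH (R : realType) :
    set (proj_line R * proj_line R * proj_line R)%type :=
  [set t | let: (l1, l2, l3) := t in
    [/\ meets_at_distinct_points l1 l2 l3,
        meets_at_distinct_points l2 l1 l3 &
        meets_at_distinct_points l3 l1 l2]].

Definition homotopic (R : realType) (X Y : topologicalType) (f g : X -> Y) : Prop :=
  exists F : R * X -> Y,
    [/\ {within `[0, 1] `*` setT, continuous F},
        forall x, F (0, x) = f x & forall x, F (1, x) = g x].

Definition homotopy_equivalent (R : realType) (X Y : topologicalType) : Prop :=
  exists (f : X -> Y) (g : Y -> X),
    [/\ continuous f, continuous g,
        homotopic R (g \o f) idfun & homotopic R (f \o g) idfun].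

Arguments frames : clear implicits.
Arguments Flag : clear implicits.
Arguments spaceH : clear implicits.

(* Main.v *)
Require Import Defs.
From mathcomp Require Import all_boot all_order all_algebra.
From mathcomp Require Import all_classical all_reals all_analysis.
From mathcomp Require Import zify.

(* A triple in H is a nondegenerate triangle: the vertices p1 = l1 & l2,
   p2 = l1 & l3, p3 = l2 & l3 are independent points, and the lines are their
   pairwise joins.  Sending it to the flag p1 < l1 < l1 + l2 and, conversely, a
   flag to the triangle of the orthogonal complements of its successive steps
   gives a retraction H -> Flag with a section; the other composite is deformed
   to the identity by the Gram-Schmidt homotopy, which replaces p2 and p3 by
   their images under 1 - t P_{p1} and 1 - t P_{l1}, where P_U is the
   orthogonal projection onto U.
   Continuity is checked through U |-> P_U, since a map into a Grassmannian is
   continuous iff its composite with U |-> P_U is: near x0, a frame A of f(x0)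
   gives the continuous local frame A *m P_{f(x)} of f(x). *)

Set Implicit Arguments.
Unset Strict Implicit.
Unset Printing Implicit Defensive.

Import Order.TTheory GRing.Theory Num.Theory.
Import numFieldNormedType.Exports.

Local Open Scope classical_set_scope.
Local Open Scope ring_scope.

(** * Limits of matrices *)

Section MatrixLimits.
Context (R : realType) (T : Type) (F : set_system T) {FF : Filter F}.

(** A neighbourhood of a matrix contains a box of neighbourhoods of its finitely many entries. *)
Lemma cvg_mx m n (f : T -> 'M[R]_(m, n)) (M : 'M[R]_(m, n)) :
  (forall i j, (f t i j) @[t --> F] --> M i j) -> f t @[t --> F] --> M.
Proof.
move=> fM A [P MP PA].
apply: (@filterS _ _ _ (fun t => forall i j, P i j (f t i j))).
  by move=> t; exact: PA.
by apply: filter_forall => i; apply: filter_forall => j; exact: fM.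
Qed.

Lemma cvg_coord m n (f : T -> 'M[R]_(m, n)) (M : 'M[R]_(m, n)) i j :
  f t @[t --> F] --> M -> (f t i j) @[t --> F] --> M i j.
Proof.
by move=> fM; exact: cvg_comp _ _ fM (@coord_continuous R m n i j M).
Qed.

Lemma cvg_mulmx m n p (f : T -> 'M[R]_(m, n)) (g : T -> 'M[R]_(n, p))
    (A : 'M[R]_(m, n)) (B : 'M[R]_(n, p)) :
  f t @[t --> F] --> A -> g t @[t --> F] --> B ->
  (f t *m g t) @[t --> F] --> A *m B.
Proof.
move=> fA gB; apply: cvg_mx => i j; rewrite mxE; under eq_cvg do rewrite mxE.
apply: cvg_big => [|k _]; first exact: add_continuous.
by apply: cvgM; exact: cvg_coord.
Qed.

Lemma cvg_trmx m n (f : T -> 'M[R]_(m, n)) (A : 'M[R]_(m, n)) :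
  f t @[t --> F] --> A -> (f t)^T @[t --> F] --> A^T.
Proof.
move=> fA; apply: cvg_mx => i j; rewrite mxE; under eq_cvg do rewrite mxE.
exact: cvg_coord.
Qed.

Lemma cvg_addmx m n (f g : T -> 'M[R]_(m, n)) (A B : 'M[R]_(m, n)) :
  f t @[t --> F] --> A -> g t @[t --> F] --> B ->
  (f t + g t) @[t --> F] --> A + B.
Proof.
move=> fA gB; apply: cvg_mx => i j; rewrite mxE; under eq_cvg do rewrite mxE.
by apply: cvgD; exact: cvg_coord.
Qed.

Lemma cvg_scalemx m n (a : T -> R) (f : T -> 'M[R]_(m, n)) (b : R)
    (A : 'M[R]_(m, n)) :
  a t @[t --> F] --> b -> f t @[t --> F] --> A ->
  (a t *: f t) @[t --> F] --> b *: A.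
Proof.
move=> ab fA; apply: cvg_mx => i j; rewrite mxE; under eq_cvg do rewrite mxE.
by apply: cvgM => //; exact: cvg_coord.
Qed.

Lemma cvg_oppmx m n (f : T -> 'M[R]_(m, n)) (A : 'M[R]_(m, n)) :
  f t @[t --> F] --> A -> (- f t) @[t --> F] --> - A.
Proof.
move=> fA; rewrite -scaleN1r; under eq_cvg do rewrite -scaleN1r.
by apply: cvg_scalemx => //; exact: cvg_cst.
Qed.

Lemma cvg_col_mx m1 m2 n (f : T -> 'M[R]_(m1, n)) (g : T -> 'M[R]_(m2, n))
    (A : 'M[R]_(m1, n)) (B : 'M[R]_(m2, n)) :
  f t @[t --> F] --> A -> g t @[t --> F] --> B ->
  (col_mx (f t) (g t)) @[t --> F] --> col_mx A B.
Proof.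
move=> fA gB; apply: cvg_mx => i j; rewrite mxE; under eq_cvg do rewrite mxE.
by case: (fintype.split i) => k; exact: cvg_coord.
Qed.

Lemma cvg_det n (f : T -> 'M[R]_n) (A : 'M[R]_n) :
  f t @[t --> F] --> A -> \det (f t) @[t --> F] --> \det A.
Proof.
move=> fA; apply: cvg_big => [|s _]; first exact: add_continuous.
apply: cvgM; first exact: cvg_cst.
by apply: cvg_big => [|i _]; [exact: mul_continuous | exact: cvg_coord].
Qed.

Lemma cvg_adjmx n (f : T -> 'M[R]_n) (A : 'M[R]_n) :
  f t @[t --> F] --> A -> \adj (f t) @[t --> F] --> \adj A.
Proof.
move=> fA; apply: cvg_mx => i j; rewrite mxE; under eq_cvg do rewrite mxE.
apply: cvgM; first exact: cvg_cst.
apply: cvg_det; apply: cvg_mx => k l.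
rewrite !mxE; under eq_cvg do rewrite !mxE.
exact: cvg_coord.
Qed.

(** Cramer's rule makes the inverse a quotient of polynomials in the entries, with nonzero
    denominator at the limit. *)
Lemma cvg_invmx n (f : T -> 'M[R]_n) (A : 'M[R]_n) : A \in unitmx ->
  f t @[t --> F] --> A -> invmx (f t) @[t --> F] --> invmx A.
Proof.
move=> Au fA; have fdet := cvg_det fA.
have A0 : \det A != 0 by rewrite -unitfE.
rewrite /invmx Au.
suff: (\det (f t))^-1 *: \adj (f t) @[t --> F] --> (\det A)^-1 *: \adj A.
  apply: cvg_trans; apply: near_eq_cvg.
  (* [invmx] returns its argument on singular matrices, so the adjugate formula is available only
     where the determinant is nonzero, which holds eventually. *)
  near=> t; rewrite unitmxE unitfE ifT //.
  by near: t; exact: (@cvgr_neq0 R R^o T F FF _ _ fdet A0).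
by apply: cvg_scalemx; [exact: cvgV | exact: cvg_adjmx].
Unshelve. all: by end_near. Qed.

End MatrixLimits.

(** * Row spaces and orthogonal projections *)

Section RowSpaces.
Variables (R : realType) (n : nat).
Implicit Types (U V : {vspace 'rV[R]_n}).

Lemma nth_rows m (A : 'M[R]_(m, n)) (i : 'I_m) : (rows A)`_i = row i A.
Proof. by rewrite -tnth_nth tnth_mktuple. Qed.

(** Dictionary between the subspaces of the statement and row spaces of matrices, on which the
    calculations take place. *)
Lemma memv_rows m (A : 'M[R]_(m, n)) v : (v \in <<rows A>>%VS) = (v <= A)%MS.
Proof.
apply/idP/idP => [/coord_span ->|/submxP[D ->]].
  apply: summx_sub => i _; apply: scalemx_sub; rewrite nth_rows; exact: row_sub.
rewrite mulmx_sum_row; apply: memv_suml => i _; apply/memvZ/memv_span.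
by apply/tnthP; exists i; rewrite tnth_mktuple.
Qed.

Lemma sub_rows m1 m2 (A : 'M[R]_(m1, n)) (B : 'M[R]_(m2, n)) :
  (<<rows A>> <= <<rows B>>)%VS = (A <= B)%MS.
Proof.
apply/subvP/rV_subP => AB v; first by rewrite -!memv_rows; exact: AB.
by rewrite !memv_rows; exact: AB.
Qed.

Lemma eq_rows m1 m2 (A : 'M[R]_(m1, n)) (B : 'M[R]_(m2, n)) :
  (A :=: B)%MS -> (<<rows A>> = <<rows B>>)%VS.
Proof. by move=> AB; apply/eqP; rewrite eqEsubv !sub_rows !AB submx_refl. Qed.

Lemma free_rows m (A : 'M[R]_(m, n)) : free (rows A) = row_free A.
Proof.
apply/idP/idP => [/freeP fA|fA].
  apply: inj_row_free => v vA; apply/rowP => i; rewrite mxE.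
  apply: (fA (v 0)); rewrite -[RHS]vA mulmx_sum_row.
  by apply: eq_bigr => j _; rewrite nth_rows.
apply/freeP => c cA i; suff /rowP/(_ i) : \row_j c j = 0 by rewrite !mxE.
apply: (row_free_inj fA); rewrite mul0mx mulmx_sum_row -[RHS]cA.
by apply: eq_bigr => j _; rewrite nth_rows mxE.
Qed.

Lemma dim_rows m (A : 'M[R]_(m, n)) : \dim <<rows A>>%VS = \rank A.
Proof.
rewrite -(eq_rows (eq_row_base A)).
apply/eqP; rewrite -[X in _ == X](size_tuple (rows (row_base A))) -/(free _).
by rewrite free_rows row_base_free.
Qed.

Lemma rows_col_mx m1 m2 (A : 'M[R]_(m1, n)) (B : 'M[R]_(m2, n)) :
  <<rows (col_mx A B)>>%VS = (<<rows A>> + <<rows B>>)%VS.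
Proof.
apply/eqP; rewrite eqEsubv subv_add !sub_rows -!addsmxE addsmxSl addsmxSr.
rewrite !andbT.
apply/subvP => v; rewrite memv_rows -addsmxE => /sub_addsmxP[[a b] /= ->].
by rewrite memv_add // memv_rows submxMl.
Qed.

Definition basis_mx U : 'M[R]_(\dim U, n) := \matrix_i tnth (vbasis U) i.

Lemma rows_basis_mx U : <<rows (basis_mx U)>>%VS = U.
Proof.
suff -> : rows (basis_mx U) = vbasis U by exact: span_basis (vbasisP U).
by apply: eq_from_tnth => i; rewrite tnth_mktuple rowK.
Qed.

Lemma basis_mx_free U : row_free (basis_mx U).
Proof. by rewrite /row_free -dim_rows rows_basis_mx. Qed.

(** The diagonal entries of [A *m A^T] are sums of squares of reals. *)
Lemma mulmx_tr_eq0 m (A : 'M[R]_(m, n)) : A *m A^T = 0 -> A = 0.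
Proof.
move=> A0; apply/matrixP => i j; rewrite mxE.
have /matrixP/(_ i i) := A0; rewrite !mxE => /eqP.
rewrite psumr_eq0 => [/allP/(_ j)|k _]; last by rewrite mxE -expr2 sqr_ge0.
by rewrite mem_index_enum mxE -expr2 sqrf_eq0 => /(_ isT)/eqP.
Qed.

(** If [v] kills the Gram matrix, then [v *m A] times its own transpose vanishes, hence so does
    [v *m A]. *)
Lemma gram_unitmx m (A : 'M[R]_(m, n)) : (A *m A^T \in unitmx) = row_free A.
Proof.
apply/idP/idP => [uA|fA].
  by apply/row_freeP; exists (A^T *m invmx (A *m A^T)); rewrite mulmxA mulmxV.
rewrite -row_free_unit; apply: inj_row_free => v vAA.
apply: (row_free_inj fA); rewrite mul0mx; apply: mulmx_tr_eq0.
by rewrite trmx_mul mulmxA -(mulmxA v) vAA mul0mx.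
Qed.

(** For row-free [A] this is the matrix of the orthogonal projection onto the row space, acting on
    row vectors from the right. *)
Definition proj_rows m (A : 'M[R]_(m, n)) : 'M[R]_n :=
  A^T *m invmx (A *m A^T) *m A.

Lemma tr_proj_rows m (A : 'M[R]_(m, n)) : (proj_rows A)^T = proj_rows A.
Proof. by rewrite /proj_rows !trmx_mul trmx_inv trmx_mul !trmxK mulmxA. Qed.

Lemma mul_proj_rows m (A : 'M[R]_(m, n)) : row_free A -> A *m proj_rows A = A.
Proof.
by move=> fA; rewrite /proj_rows !mulmxA mulmxV ?mul1mx ?gram_unitmx.
Qed.

Lemma eqmx_proj_rows m (A : 'M[R]_(m, n)) :
  row_free A -> (proj_rows A :=: A)%MS.
Proof.
move=> fA; apply/eqmxP; rewrite submxMl /=.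
by rewrite -{1}(mul_proj_rows fA) submxMl.
Qed.

(** Each projection absorbs the other: [P *m Q = P] and [Q *m P = Q]. Transposing the first
    identity, with both matrices symmetric, gives [P = Q]. Hence [orthproj] does not depend on the
    basis chosen. *)
Lemma eq_proj_rows m1 m2 (A : 'M[R]_(m1, n)) (B : 'M[R]_(m2, n)) :
  row_free A -> row_free B -> (A :=: B)%MS -> proj_rows A = proj_rows B.
Proof.
have absorb k1 k2 (C : 'M[R]_(k1, n)) (D : 'M[R]_(k2, n)) :
    row_free D -> (C <= D)%MS -> proj_rows C *m proj_rows D = proj_rows C.
  move=> fD /submxP[E CE]; have CD : C *m proj_rows D = C.
    by rewrite CE -mulmxA mul_proj_rows.
  transitivity (C^T *m invmx (C *m C^T) *m (C *m proj_rows D)).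
    by rewrite mulmxA.
  by rewrite CD.
move=> fA fB AB; have PQ := absorb _ _ A B; have QP := absorb _ _ B A.
by rewrite -[LHS]tr_proj_rows -PQ ?AB // trmx_mul !tr_proj_rows QP ?AB.
Qed.

Definition orthproj U : 'M[R]_n := proj_rows (basis_mx U).

Lemma orthproj_rows m (A : 'M[R]_(m, n)) :
  row_free A -> orthproj <<rows A>>%VS = proj_rows A.
Proof.
move=> fA; apply: eq_proj_rows; rewrite ?basis_mx_free //.
by apply/eqmxP; rewrite -!sub_rows rows_basis_mx subvv.
Qed.

Lemma rows_orthproj U : <<rows (orthproj U)>>%VS = U.
Proof.
by rewrite (eq_rows (eqmx_proj_rows (basis_mx_free U))) rows_basis_mx.
Qed.

Lemma memv_orthproj U v : (v \in U) = (v <= orthproj U)%MS.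
Proof. by rewrite -memv_rows rows_orthproj. Qed.

Lemma rank_orthproj U : \rank (orthproj U) = \dim U.
Proof. by rewrite -dim_rows rows_orthproj. Qed.

Lemma tr_orthproj U : (orthproj U)^T = orthproj U.
Proof. exact: tr_proj_rows. Qed.

Lemma orthproj_id m (A : 'M[R]_(m, n)) U :
  (A <= orthproj U)%MS -> A *m orthproj U = A.
Proof.
rewrite /orthproj eqmx_proj_rows ?basis_mx_free // => /submxP[D ->].
by rewrite -mulmxA mul_proj_rows ?basis_mx_free.
Qed.

Lemma orthproj_idem U : orthproj U *m orthproj U = orthproj U.
Proof. exact: orthproj_id. Qed.

Lemma mulmx_tr_sub p m1 m2 (v : 'M[R]_(p, n)) (A : 'M[R]_(m1, n))
    (B : 'M[R]_(m2, n)) : (A <= B)%MS -> v *m B^T = 0 -> v *m A^T = 0.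
Proof. by move=> /submxP[C ->] vB; rewrite trmx_mul mulmxA vB mul0mx. Qed.

(** The two blocks span the orthogonal complements of [U] and [V]. Intersections are thereby reduced
    to row spans, where limits are easier to control. *)
Definition orthsum_mx U V : 'M[R]_(n + n, n) :=
  col_mx (1%:M - orthproj U) (1%:M - orthproj V).

Definition orthsum U V : {vspace 'rV[R]_n} := <<rows (orthsum_mx U V)>>%VS.

(* [orthsum U V] is the orthogonal complement of [U :&: V]. *)
Lemma memv_capE U V v :
  (v \in (U :&: V)%VS) = (v *m orthproj (orthsum U V) == 0).
Proof.
have memE (W : {vspace _}) : (v \in W) = (v *m (1%:M - orthproj W) == 0).
  rewrite memv_orthproj mulmxBr mulmx1 subr_eq0.
  by apply/idP/eqP => [/orthproj_id//|->]; exact: submxMl.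
(* The projection and [orthsum_mx U V] have the same row space, so a vector orthogonal to the rows
   of one is orthogonal to the rows of the other; the projection is its own transpose. *)
have -> : (v *m orthproj (orthsum U V) == 0) = (v *m (orthsum_mx U V)^T == 0).
  have /eqP := rows_orthproj (orthsum U V); rewrite eqEsubv !sub_rows.
  move=> /andP[le ge]; rewrite -[orthproj _]tr_orthproj.
  by apply/eqP/eqP; apply: mulmx_tr_sub.
rewrite memv_cap !memE tr_col_mx mul_mx_row !linearB /= !tr_orthproj trmx1.
by rewrite row_mx_eq0.
Qed.

(** With [P] and [Q] the projections onto [U :&: V] and [orthsum U V], one has [P *m Q = 0] and
    [(1 - Q) *m P = 1 - Q]. By transposition [Q *m P = 0], so [P = 1 - Q]. *)
Lemma orthproj_cap U V : orthproj (U :&: V)%VS = 1%:M - orthproj (orthsum U V).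
Proof.
set W := orthsum U V; set P := orthproj (U :&: V)%VS.
have PW : P *m orthproj W = 0.
  apply/row_matrixP => i; rewrite row_mul row0; apply/eqP.
  by rewrite -memv_capE memv_orthproj row_sub.
have WP : (1%:M - orthproj W) *m P = 1%:M - orthproj W.
  apply: orthproj_id; apply/row_subP => i; rewrite -memv_orthproj memv_capE.
  by rewrite -row_mul mulmxBl mul1mx orthproj_idem subrr row0.
rewrite -WP mulmxBl mul1mx -[orthproj W *m P]trmxK trmx_mul !tr_orthproj PW.
by rewrite trmx0 subr0.
Qed.

(** Rank-nullity, since [U :&: V] is the kernel of the projection onto [orthsum U V]. *)
Lemma rank_orthsum_mx U V : \rank (orthsum_mx U V) = (n - \dim (U :&: V))%N.
Proof.
rewrite -dim_rows -(rank_orthproj (orthsum U V)).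
suff -> : \dim (U :&: V) = (n - \rank (orthproj (orthsum U V)))%N.
  by rewrite subKn // rank_leq_row.
rewrite -mxrank_ker -dim_rows; congr (\dim _); apply/eqP; rewrite eqEsubv.
apply/andP; split; apply/subvP => v; rewrite memv_rows memv_capE.
  by move/eqP => /sub_kermxP.
by move/sub_kermxP => ->.
Qed.

End RowSpaces.

(** * Limits of orthogonal projections *)

Section ProjectionLimits.
Context (R : realType) (n : nat) (T : Type) (F : set_system T) {FF : Filter F}.

(** Freeness is the nonvanishing of the Gram determinant, an open condition. *)
Lemma near_row_free k (f : T -> 'M[R]_(k, n)) (A : 'M[R]_(k, n)) :
  row_free A -> f t @[t --> F] --> A -> \forall t \near F, row_free (f t).
Proof.
move=> fA fcvg.
have dA : \det (A *m A^T) != 0 by rewrite -unitfE -unitmxE gram_unitmx.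
have fdet : \det (f t *m (f t)^T) @[t --> F] --> \det (A *m A^T).
  by apply: cvg_det; apply: cvg_mulmx => //; exact: cvg_trmx.
near=> t; rewrite -gram_unitmx unitmxE unitfE.
by near: t; exact: (@cvgr_neq0 R R^o T F FF _ _ fdet dA).
Unshelve. all: by end_near. Qed.

Lemma cvg_proj_rows k (f : T -> 'M[R]_(k, n)) (A : 'M[R]_(k, n)) :
  row_free A -> f t @[t --> F] --> A ->
  proj_rows (f t) @[t --> F] --> proj_rows A.
Proof.
rewrite -gram_unitmx => uA fcvg.
have ftr : (f t)^T @[t --> F] --> A^T by exact: cvg_trmx.
exact: cvg_mulmx (cvg_mulmx ftr (cvg_invmx uA (cvg_mulmx fcvg ftr))) fcvg.
Qed.

(** The rows may be dependent. A fixed [C] extracting a basis of the row space of [A] gives rows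
    [C *m f t] that are eventually free, and by constancy of the rank they then span the whole row
    space of [f t]. *)
Lemma cvg_orthproj m (f : T -> 'M[R]_(m, n)) (A : 'M[R]_(m, n)) :
  (forall t, \rank (f t) = \rank A) -> f t @[t --> F] --> A ->
  orthproj <<rows (f t)>> @[t --> F] --> orthproj <<rows A>>.
Proof.
move=> rk fcvg.
have /submxP[C AC] : (row_base A <= A)%MS by rewrite eq_row_base.
have Cf : (C *m f t) @[t --> F] --> row_base A.
  by rewrite AC; apply: cvg_mulmx => //; exact: cvg_cst.
rewrite -(eq_rows (eq_row_base A)) orthproj_rows ?row_base_free //.
suff : proj_rows (C *m f t) @[t --> F] --> proj_rows (row_base A).
  apply: cvg_trans; apply: near_eq_cvg; near=> t.
  have Cfree : row_free (C *m f t).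
    by near: t; apply: near_row_free Cf; exact: row_base_free.
  rewrite -orthproj_rows //; congr orthproj; apply: eq_rows; apply/eqmxP.
  by rewrite -mxrank_leqif_eq ?submxMl // rk (eqP Cfree).
by apply: cvg_proj_rows => //; exact: row_base_free.
Unshelve. all: by end_near. Qed.

End ProjectionLimits.

(** * The topology of the Grassmannian, read through projections *)

Section GrassmannianTopology.
Variables (R : realType) (k n : nat).

Lemma frames_free (A : 'M[R]_(k, n)) : (A \in frames R k n) = row_free A.
Proof. by rewrite -free_rows; apply/idP/idP => [/set_mem|/mem_set]. Qed.

Lemma Gr_frame (U : Gr R k n) :
  exists2 A : 'M[R]_(k, n), row_free A & <<rows A>>%VS = U.
Proof.
have dU : \dim U = k := eqP (valP U).
have := rows_basis_mx U; have := basis_mx_free U.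
by move: (basis_mx U); rewrite dU => A fA AU; exists A.
Qed.

(** The topology is final for [frame_span], so only the composite with [frame_span] matters, and
    that is [proj_rows]. *)
Lemma orthproj_continuous : continuous (fun U : Gr R k n => orthproj U).
Proof.
apply/continuousP => O oO.
suff : continuous (fun A : frames R k n => proj_rows (val A)).
  move=> /continuousP/(_ O oO); congr open; apply: funext => -[A fA] /=.
  by rewrite orthproj_rows //= -?frames_free.
move=> A; have rA : row_free (val A) by rewrite -frames_free; exact: valP A.
by apply: (@cvg_proj_rows R n _ (nbhs A)) => //; exact: initial_continuous.
Qed.

Lemma cvg_Gr (T : Type) (F : set_system T) {FF : Filter F} (f : T -> Gr R k n)
    (U : Gr R k n) :
  orthproj (f t) @[t --> F] --> orthproj U -> f t @[t --> F] --> U.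
Proof.
move=> fU; have [A fA AU] := Gr_frame U.
have AfA : (A *m orthproj (f t)) @[t --> F] --> A.
  rewrite -[X in _ --> X](@orthproj_id _ _ _ _ U).
    by apply: cvg_mulmx => //; exact: cvg_cst.
  by rewrite -sub_rows rows_orthproj AU subvv.
(* The preimage of the open set [O] under [frame_span] is the trace on frames of an open set [W] of
   matrices. *)
move=> S; rewrite nbhsE => nS; case: nS => O oO OS; case: oO => -[W oW WO] OU.
apply: (filterS (P := fun t => O (f t))); first by move=> t; exact: OS.
have fAin : A \in frames R k n by rewrite frames_free.
(* Membership of [V] in [O] can be tested by [W] on any frame of [V]; a frame whose rows lie in [V]
   spans it by dimension. *)
have frameP (B : 'M[R]_(k, n)) (fB : B \in frames R k n) (V : Gr R k n) :
    (B <= orthproj V)%MS -> O V = W B.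
  move=> BV; suff -> : V = frame_span (exist _ B fB).
    by rewrite -[LHS]/((_ @^-1` O) _) -WO.
  apply/val_inj/eqP; rewrite eq_sym eqEdim.
  rewrite -[X in (_ <= X)%VS](rows_orthproj V) sub_rows BV.
  by rewrite andTb (eqP (valP V)) (eqP (valP (frame_span _))).
have WA : W A by rewrite -(frameP _ fAin U) // -sub_rows rows_orthproj AU subvv.
near=> t.
have fB : A *m orthproj (f t) \in frames R k n.
  by rewrite frames_free; near: t; exact: near_row_free AfA.
rewrite (frameP _ fB) ?submxMl //; near: t; apply: AfA.
exact: open_nbhs_nbhs.
Unshelve. all: by end_near. Qed.

End GrassmannianTopology.

(** * Gram-Schmidt shears and triangles *)

Section Shear.
Variables (R : realType) (n : nat).
Implicit Types (t : R) (U V W : {vspace 'rV[R]_n}).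

(** A path from the identity at [t = 0] to the orthogonal projection onto the complement of [U] at
    [t = 1]. *)
Definition shear_fun t U : 'End('rV[R]_n) :=
  linfun (mulmxr (1%:M - t *: orthproj U)).

Definition shear t U W : {vspace 'rV[R]_n} := (shear_fun t U @: W)%VS.

Lemma shear_funE t U v : shear_fun t U v = v - t *: (v *m orthproj U).
Proof. by rewrite lfunE /= mulmxBr mulmx1 -scalemxAr. Qed.

(** Presents the sheared subspace as the row span of a matrix depending continuously on [t] and on
    both projections. *)
Lemma shear_rows t U W :
  shear t U W = <<rows (orthproj W *m (1%:M - t *: orthproj U))>>%VS.
Proof.
apply/vspaceP => v; rewrite memv_rows; apply/memv_imgP/idP.
  by move=> [w wW ->]; rewrite lfunE /= submxMr // -memv_orthproj.
move=> /submxP[D ->]; exists (D *m orthproj W); last by rewrite lfunE /= mulmxA.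
by rewrite memv_orthproj submxMl.
Qed.

Lemma shear0 U W : shear 0 U W = W.
Proof. by rewrite shear_rows scale0r subr0 mulmx1 rows_orthproj. Qed.

Lemma shear1_ker U W : (U <= W)%VS -> (U <= W :&: lker (shear_fun 1 U))%VS.
Proof.
move=> UW; rewrite subv_cap UW; apply/subvP => u uU.
rewrite memv_ker shear_funE scale1r orthproj_id ?subrr //.
by rewrite -memv_orthproj.
Qed.

(** At [t = 1] the summand [U] is killed. *)
Lemma shear1_addl U W : shear 1 U (U + W) = shear 1 U W.
Proof.
rewrite /shear limgD (_ : (_ @: U)%VS = 0%VS) ?add0v //.
apply/eqP; rewrite -lkerE; apply: subv_trans (capvSr U _).
exact: shear1_ker.
Qed.

(** Rank-nullity on [W]: the kernel contains [U]. *)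
Lemma dim_shear1 U W : (U <= W)%VS -> (\dim (shear 1 U W) <= \dim W - \dim U)%N.
Proof.
move=> UW; rewrite leq_subRL ?dimvS // -(limg_ker_dim (shear_fun 1 U) W).
by rewrite leq_add2r dimvS // shear1_ker.
Qed.

Lemma dim_shear t U W : (\dim (shear t U W) <= \dim W)%N.
Proof. by rewrite -(limg_ker_dim (shear_fun t U) W) leq_addl. Qed.

(** A shear moves each vector by an element of [U]. This is what preserves the side and the plane of
    a triangle during the deformation. *)
Lemma addv_shear t U W : (U + shear t U W = U + W)%VS.
Proof.
have projU v : t *: (v *m orthproj U) \in U.
  by rewrite memvZ // memv_orthproj submxMl.
apply/eqP; rewrite eqEsubv !subv_add !addvSl /=; apply/andP; split.
  apply/subvP => _ /memv_imgP[w wW ->]; rewrite shear_funE addrC.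
  by rewrite memv_add ?memvN.
apply/subvP => w wW; rewrite -(subrK (t *: (w *m orthproj U)) w) addrC.
by rewrite memv_add // -shear_funE memv_img.
Qed.

End Shear.

(** * Independent triples of points *)

Section Triangles.
Variables (R : realType) (n : nat).
Implicit Types p q : {vspace 'rV[R]_n}.

(** Upper bounds suffice, since a sum of dimension 3 forces each term to have dimension 1; they pass
    directly to images under shears. *)
Definition indep3 p1 p2 p3 : Prop :=
  [/\ (\dim p1 <= 1)%N, (\dim p2 <= 1)%N, (\dim p3 <= 1)%N &
      \dim (p1 + p2 + p3) = 3].

Lemma indep3_213 p1 p2 p3 : indep3 p1 p2 p3 -> indep3 p2 p1 p3.
Proof. by case=> ? ? ? d; split=> //; rewrite (addvC p2). Qed.

Lemma indep3_132 p1 p2 p3 : indep3 p1 p2 p3 -> indep3 p1 p3 p2.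
Proof. by case=> ? ? ? d; split=> //; rewrite -addvA (addvC p3) addvA. Qed.

Lemma dim_indep3 p1 p2 p3 : indep3 p1 p2 p3 -> \dim p1 = 1.
Proof.
case; have := dimv_sum_cap (p1 + p2) p3; have := dimv_sum_cap p1 p2; lia.
Qed.

Lemma dim_indep3D p1 p2 p3 : indep3 p1 p2 p3 -> \dim (p1 + p2) = 2.
Proof.
case; have := dimv_sum_cap (p1 + p2) p3; have := dimv_sum_cap p1 p2; lia.
Qed.

(** The intersection contains [p1] and has dimension 2 + 2 - 3 = 1. *)
Lemma cap_indep3 p1 p2 p3 :
  indep3 p1 p2 p3 -> ((p1 + p2) :&: (p1 + p3) = p1)%VS.
Proof.
move=> ind; apply/eqP; rewrite eq_sym eqEdim subv_cap !addvSl /=.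
have := dimv_sum_cap (p1 + p2) (p1 + p3).
rewrite (dim_indep3D ind) (dim_indep3D (indep3_132 ind)) (dim_indep3 ind).
have -> : (p1 + p2 + (p1 + p3) = p1 + p2 + p3)%VS.
  by rewrite (addvC p1 p2) -!addvA (addvA p1 p1) addvv addvA (addvC p2) -addvA.
case: ind => _ _ _ ->; lia.
Qed.

Lemma neq_indep3 p1 p2 p3 : indep3 p1 p2 p3 -> p1 != p2.
Proof.
move=> ind; apply/eqP => e; have := dim_indep3D ind.
by rewrite -e addvv (dim_indep3 ind).
Qed.

Lemma dim_addv_lines p q :
  \dim p = 1 -> \dim q = 1 -> p != q -> \dim (p + q) = 2.
Proof.
move=> dp dq pq; have := dimv_sum_cap p q.
have : (\dim (p :&: q) != 1)%N.
  apply: contra_neqN pq => /eqP d.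
  have /eqP <- : (p :&: q)%VS == p by rewrite eqEdim capvSl d dp.
  by apply/eqP; rewrite eqEdim capvSr d dq.
have := dimvS (capvSl p q); lia.
Qed.

End Triangles.

(** * Points of H as triples of independent vertices *)

Section SpaceH.
Variable R : realType.
Implicit Types (l m : proj_line R) (p : {vspace 'rV[R]_4}).

Lemma dim_line l : \dim l = 2.
Proof. exact: eqP (valP l). Qed.

Lemma line_inj l m : l = m :> {vspace 'rV[R]_4} -> l = m.
Proof. exact: val_inj. Qed.

Lemma dim_meet_lines l m : meet_lines l m -> \dim (l :&: m) = 1.
Proof.
case=> lm; rewrite -dimv_eq0.
have : (\dim (l :&: m) != 2)%N.
  apply: contra_neqN lm => /eqP d; apply: line_inj.
  have /eqP <- : (l :&: m)%VS == l by rewrite eqEdim capvSl d dim_line.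
  by apply/eqP; rewrite eqEdim capvSr d dim_line.
have := dimvS (capvSl l m); rewrite dim_line; lia.
Qed.

Lemma meet_lines_indep3 l m p1 p2 p3 : indep3 p1 p2 p3 ->
  l = (p1 + p2)%VS :> {vspace 'rV[R]_4} ->
  m = (p1 + p3)%VS :> {vspace 'rV[R]_4} ->
  meet_lines l m /\ (l :&: m = p1)%VS.
Proof.
move=> ind el em; have e : (l :&: m = p1)%VS by rewrite el em cap_indep3.
split=> //; split; last by rewrite e -dimv_eq0 (dim_indep3 ind).
apply/eqP => lm; move: e; rewrite lm capvv => e.
by have := dim_line m; rewrite e (dim_indep3 ind).
Qed.

(** Permuting the vertices covers the six ordered pairs of sides; each pair meets in its common
    vertex, and the vertices are distinct. *)
Lemma spaceH_indep3 l1 l2 l3 p1 p2 p3 : indep3 p1 p2 p3 ->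
  l1 = (p1 + p2)%VS :> {vspace 'rV[R]_4} ->
  l2 = (p1 + p3)%VS :> {vspace 'rV[R]_4} ->
  l3 = (p2 + p3)%VS :> {vspace 'rV[R]_4} -> spaceH R (l1, l2, l3).
Proof.
move=> i123 e1 e2 e3.
have i132 := indep3_132 i123; have i213 := indep3_213 i123.
have i231 := indep3_132 i213; have i312 := indep3_213 i132.
have i321 := indep3_132 i312.
have e1' : l1 = (p2 + p1)%VS :> {vspace 'rV[R]_4} by rewrite addvC.
have e2' : l2 = (p3 + p1)%VS :> {vspace 'rV[R]_4} by rewrite addvC.
have e3' : l3 = (p3 + p2)%VS :> {vspace 'rV[R]_4} by rewrite addvC.
have [m12 c12] := meet_lines_indep3 i123 e1 e2.
have [m21 c21] := meet_lines_indep3 i132 e2 e1.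
have [m13 c13] := meet_lines_indep3 i213 e1' e3.
have [m31 c31] := meet_lines_indep3 i231 e3 e1'.
have [m23 c23] := meet_lines_indep3 i312 e2' e3'.
have [m32 c32] := meet_lines_indep3 i321 e3' e2'.
split; split=> //; rewrite ?(c12, c13, c21, c23, c31, c32).
- exact: neq_indep3 i123.
- exact: neq_indep3 i132.
- exact: neq_indep3 i231.
Qed.

(** Two distinct points of a projective line span it. *)
Lemma addv_vertices l m1 m2 : meets_at_distinct_points l m1 m2 ->
  (l :&: m1 + l :&: m2)%VS = l.
Proof.
case=> c1 c2 neq; apply/eqP; rewrite eqEdim subv_add !capvSl /=.
rewrite dim_line.
by rewrite (dim_addv_lines (dim_meet_lines c1) (dim_meet_lines c2) neq).
Qed.

(** The three vertices together span [l1 + l2], of dimension 2 + 2 - 1 = 3. *)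
Lemma spaceH_vertices l1 l2 l3 : spaceH R (l1, l2, l3) ->
  [/\ indep3 (l1 :&: l2) (l1 :&: l3) (l2 :&: l3),
      (l1 :&: l2 + l1 :&: l3)%VS = l1, (l1 :&: l2 + l2 :&: l3)%VS = l2 &
      (l1 :&: l3 + l2 :&: l3)%VS = l3].
Proof.
case=> h1 h2 h3; have a1 := addv_vertices h1.
have a2 := addv_vertices h2; have a3 := addv_vertices h3.
rewrite (capvC l2 l1) in a2; rewrite (capvC l3 l1) (capvC l3 l2) in a3.
split=> //; case: h1 h2 => m12 m13 _ [_ m23 _].
split; rewrite ?dim_meet_lines //.
rewrite a1; have -> : (l1 + l2 :&: l3 = l1 + l2)%VS.
  by rewrite -[in RHS]a2 addvA (addv_idPl (capvSl l1 l2)).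
by have := dimv_sum_cap l1 l2; rewrite dim_meet_lines // !dim_line; lia.
Qed.

End SpaceH.

(** * Continuity of families of subspaces *)

Section SubspaceFamilies.
Variables (R : realType) (n : nat) (X : topologicalType).
Implicit Types U V W : X -> {vspace 'rV[R]_n}.

(** Testing continuity on projections keeps the dimension out of the type of the family; the
    operations below ask for constant dimension instead. *)
Definition vcontinuous U := continuous (fun x => orthproj (U x)).

Lemma vcontinuous_rows m (B : X -> 'M[R]_(m, n)) k :
  continuous B -> (forall x, \rank (B x) = k) ->
  vcontinuous (fun x => <<rows (B x)>>%VS).
Proof.
move=> cB rB x; apply: (@cvg_orthproj R n X (nbhs x)) => [y|].
  by rewrite !rB.
exact: cB.
Qed.

Lemma vcontinuousD U V k : vcontinuous U -> vcontinuous V ->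
  (forall x, \dim (U x + V x) = k) -> vcontinuous (fun x => (U x + V x)%VS).
Proof.
move=> cU cV dk.
have eUV x :
    <<rows (col_mx (orthproj (U x)) (orthproj (V x)))>>%VS = (U x + V x)%VS.
  by rewrite rows_col_mx !rows_orthproj.
rewrite /vcontinuous; under eq_fun do rewrite -eUV.
apply: vcontinuous_rows => [x|x]; last by rewrite -dim_rows eUV.
by apply: (@cvg_col_mx R X (nbhs x)); [exact: cU | exact: cV].
Qed.

(** Taking orthogonal complements turns the intersection into a row span of constant rank. *)
Lemma vcontinuousI U V k : vcontinuous U -> vcontinuous V ->
  (forall x, \dim (U x :&: V x) = k) -> vcontinuous (fun x => (U x :&: V x)%VS).
Proof.
move=> cU cV dk; rewrite /vcontinuous; under eq_fun do rewrite orthproj_cap.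
have c1 W : vcontinuous W -> continuous (fun x => 1%:M - orthproj (W x)).
  move=> cW x; apply: (@cvg_addmx R X (nbhs x)); first exact: cvg_cst.
  by apply: (@cvg_oppmx R X (nbhs x)); exact: cW.
apply: (c1); apply: vcontinuous_rows => [x|x];
  last by rewrite rank_orthsum_mx dk.
by apply: (@cvg_col_mx R X (nbhs x)); [exact: c1 | exact: c1].
Qed.

Lemma vcontinuous_shear (t : X -> R) U W k : continuous t ->
  vcontinuous U -> vcontinuous W ->
  (forall x, \dim (shear (t x) (U x) (W x)) = k) ->
  vcontinuous (fun x => shear (t x) (U x) (W x)).
Proof.
move=> ct cU cW dk; rewrite /vcontinuous; under eq_fun do rewrite shear_rows.
apply: vcontinuous_rows => [x|x]; last by rewrite -dim_rows -shear_rows.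
apply: (@cvg_mulmx R X (nbhs x)); first exact: cW.
apply: (@cvg_addmx R X (nbhs x)); first exact: cvg_cst.
apply: (@cvg_oppmx R X (nbhs x)).
by apply: (@cvg_scalemx R X (nbhs x)); [exact: ct | exact: cU].
Qed.

Lemma vcontinuous_cst (U0 : {vspace 'rV[R]_n}) : vcontinuous (fun=> U0).
Proof. by move=> x; exact: cvg_cst. Qed.

Lemma vcontinuous_Gr k (f : X -> Gr R k n) :
  continuous f <-> vcontinuous (fun x => f x).
Proof.
split=> cf x; last by apply: (@cvg_Gr R k n X (nbhs x)); exact: cf.
apply: (@continuous_comp _ _ _ f (fun V : Gr R k n => orthproj V)).
  exact: cf.
exact: orthproj_continuous.
Qed.

End SubspaceFamilies.

(** * Triangles as points of H *)

Section Triangle.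
Variable R : realType.
Implicit Types p : {vspace 'rV[R]_4}.

Definition line_through p q (d : \dim (p + q) = 2) : proj_line R :=
  Sub (p + q)%VS (introT eqP d).

Definition triangle_lines p1 p2 p3 (ind : indep3 p1 p2 p3) :=
  (line_through (dim_indep3D ind),
   line_through (dim_indep3D (indep3_132 ind)),
   line_through (dim_indep3D (indep3_132 (indep3_213 ind)))).

Lemma triangle_subproof p1 p2 p3 (ind : indep3 p1 p2 p3) :
  triangle_lines ind \in spaceH R.
Proof. by apply/mem_set; apply: (spaceH_indep3 ind). Qed.

Definition triangle p1 p2 p3 (ind : indep3 p1 p2 p3) : spaceH R :=
  exist _ (triangle_lines ind) (triangle_subproof ind).

Definition side1 (x : spaceH R) : proj_line R := (val x).1.1.
Definition side2 (x : spaceH R) : proj_line R := (val x).1.2.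
Definition side3 (x : spaceH R) : proj_line R := (val x).2.

Lemma side1_triangle p1 p2 p3 (ind : indep3 p1 p2 p3) :
  side1 (triangle ind) = (p1 + p2)%VS :> {vspace 'rV[R]_4}.
Proof. by []. Qed.

Lemma side2_triangle p1 p2 p3 (ind : indep3 p1 p2 p3) :
  side2 (triangle ind) = (p1 + p3)%VS :> {vspace 'rV[R]_4}.
Proof. by []. Qed.

Lemma side3_triangle p1 p2 p3 (ind : indep3 p1 p2 p3) :
  side3 (triangle ind) = (p2 + p3)%VS :> {vspace 'rV[R]_4}.
Proof. by []. Qed.

Lemma eq_triangle p1 p2 p3 q1 q2 q3 (indp : indep3 p1 p2 p3)
    (indq : indep3 q1 q2 q3) :
  p1 = q1 -> p2 = q2 -> p3 = q3 -> triangle indp = triangle indq.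
Proof.
move=> e1 e2 e3; move: indp indq; rewrite e1 e2 e3 => indp indq.
by congr triangle; exact: Prop_irrelevance.
Qed.

Lemma spaceH_eq (x y : spaceH R) :
  side1 x = side1 y :> {vspace 'rV[R]_4} ->
  side2 x = side2 y :> {vspace 'rV[R]_4} ->
  side3 x = side3 y :> {vspace 'rV[R]_4} -> x = y.
Proof.
move=> e1 e2 e3; apply: val_inj; rewrite [LHS]surjective_pairing.
rewrite [RHS]surjective_pairing [in LHS](surjective_pairing (val x).1).
rewrite [in RHS](surjective_pairing (val y).1).
by congr (_, _, _); apply: line_inj.
Qed.

Definition vertex12 x : {vspace 'rV[R]_4} := (side1 x :&: side2 x)%VS.
Definition vertex13 x : {vspace 'rV[R]_4} := (side1 x :&: side3 x)%VS.
Definition vertex23 x : {vspace 'rV[R]_4} := (side2 x :&: side3 x)%VS.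

Lemma verticesP x :
  [/\ indep3 (vertex12 x) (vertex13 x) (vertex23 x),
      (vertex12 x + vertex13 x)%VS = side1 x,
      (vertex12 x + vertex23 x)%VS = side2 x &
      (vertex13 x + vertex23 x)%VS = side3 x].
Proof.
rewrite /vertex12 /vertex13 /vertex23 /side1 /side2 /side3.
have := set_mem (valP x).
by case: (val x) => -[l1 l2] l3; exact: spaceH_vertices.
Qed.

Lemma indep3_vertices x : indep3 (vertex12 x) (vertex13 x) (vertex23 x).
Proof. by case: (verticesP x). Qed.

(** H has the subspace topology of a product, so it is enough to treat each side, a sum of constant
    dimension 2. *)
Lemma triangle_continuous (X : topologicalType)
    (p1 p2 p3 : X -> {vspace 'rV[R]_4})
    (ind : forall x, indep3 (p1 x) (p2 x) (p3 x)) :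
  vcontinuous p1 -> vcontinuous p2 -> vcontinuous p3 ->
  continuous (fun x => triangle (ind x)).
Proof.
move=> c1 c2 c3; apply: continuous_comp_initial.
have cl q1 q2 (d : forall x, \dim (q1 x + q2 x) = 2) :
    vcontinuous q1 -> vcontinuous q2 ->
    continuous (fun x : X => line_through (d x)).
  by move=> cq1 cq2; apply/vcontinuous_Gr; exact: vcontinuousD d.
have cpair (A B : topologicalType) (f : X -> A) (g : X -> B) :
    continuous f -> continuous g -> continuous (fun x => (f x, g x)).
  by move=> cf cg x; apply: cvg_pair; [exact: cf | exact: cg].
by apply: (cpair _ _ _ _ (cpair _ _ _ _ (cl _ _ _ _ _) (cl _ _ _ _ _))
                 (cl _ _ _ _ _)).
Qed.

Lemma sides_continuous :
  [/\ vcontinuous side1, vcontinuous side2 & vcontinuous side3].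
Proof.
have cval : continuous
    (val : spaceH R -> proj_line R * proj_line R * proj_line R).
  exact: initial_continuous.
have cfst (A B : topologicalType) (f : spaceH R -> A * B) :
    continuous f -> continuous (fun x => (f x).1).
  move=> cf x; apply: (@continuous_comp _ _ _ f fst); first exact: cf.
  exact: cvg_fst.
have csnd (A B : topologicalType) (f : spaceH R -> A * B) :
    continuous f -> continuous (fun x => (f x).2).
  move=> cf x; apply: (@continuous_comp _ _ _ f snd); first exact: cf.
  exact: cvg_snd.
split; apply/vcontinuous_Gr.
- exact: cfst (cfst _ _ _ cval).
- exact: csnd (cfst _ _ _ cval).
- exact: csnd cval.
Qed.

Lemma dim_vertex12 x : \dim (vertex12 x) = 1.
Proof. exact: dim_indep3 (indep3_vertices x). Qed.

Lemma dim_vertex13 x : \dim (vertex13 x) = 1.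
Proof. exact: dim_indep3 (indep3_213 (indep3_vertices x)). Qed.

Lemma dim_vertex23 x : \dim (vertex23 x) = 1.
Proof. exact: dim_indep3 (indep3_213 (indep3_132 (indep3_vertices x))). Qed.

Lemma vertex12_continuous : vcontinuous vertex12.
Proof.
have [c1 c2 c3] := sides_continuous.
exact: (vcontinuousI c1 c2 dim_vertex12).
Qed.

Lemma vertex13_continuous : vcontinuous vertex13.
Proof.
have [c1 c2 c3] := sides_continuous.
exact: (vcontinuousI c1 c3 dim_vertex13).
Qed.

Lemma vertex23_continuous : vcontinuous vertex23.
Proof.
have [c1 c2 c3] := sides_continuous.
exact: (vcontinuousI c2 c3 dim_vertex23).
Qed.

End Triangle.

(** * The homotopy equivalence *)

Section Equivalence.
Variable R : realType.
Implicit Types (x : spaceH R) (V : Flag R 4).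

Definition flag_space (x : spaceH R) (i : nat) : {vspace 'rV[R]_4} :=
  match i with
  | 0 => 0%VS
  | 1 => vertex12 x
  | 2 => side1 x
  | 3 => (side1 x + side2 x)%VS
  | _ => fullv
  end.

(** The second side is spanned by [vertex12 x], already in the first side, and [vertex23 x]. *)
Lemma side1D2 x : (side1 x + side2 x)%VS = (side1 x + vertex23 x)%VS.
Proof.
have [_ _ e2 _] := verticesP x.
by rewrite -e2 addvA (addv_idPl (capvSl _ _)).
Qed.

Lemma dim_flag_space x (i : 'I_5) : \dim (flag_space x i) = i.
Proof.
case: i => -[|[|[|[|[|//]]]]] _ /=.
- exact: dimv0.
- exact: dim_vertex12.
- exact: dim_line.
- rewrite side1D2; have [ind <- _ _] := verticesP x.
  by case: ind.
- by rewrite dimvf dim_matrix.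
Qed.

Definition flag_spaces (x : spaceH R) :
    prod_topology (fun i : 'I_5 => Gr R i 4) :=
  fun i => Sub (flag_space x i) (introT eqP (dim_flag_space x i)).

Lemma flag_spaces_subproof x : flag_spaces x \in Flag R 4.
Proof.
apply/mem_set => i j ij; rewrite /flag_spaces /= /Gr_vspace !SubK ij.
case: i j ij => -[|[|[|[|i]]]] //= _ j _.
- exact: sub0v.
- exact: capvSl.
- exact: addvSl.
- exact: subvf.
Qed.

Definition flag_of_triangle (x : spaceH R) : Flag R 4 :=
  exist _ (flag_spaces x) (flag_spaces_subproof x).

(** The product topology is the supremum of the initial topologies of the projections, so each step
    of the flag is treated separately. *)
Lemma continuous_Flag (X : topologicalType) (f : X -> Flag R 4) :
  (forall i, vcontinuous (fun u => val (f u) i)) -> continuous f.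
Proof.
move=> cf; apply: continuous_comp_initial => u; apply/cvg_sup => i.
have cfi : continuous ((fun u => val (f u)) :
    X -> initial_topology (fun h : (forall i : 'I_5, Gr R i 4) => h i)).
  by apply: continuous_comp_initial; apply/vcontinuous_Gr; exact: cf.
exact: cfi.
Qed.

Lemma flag_of_triangle_continuous : continuous flag_of_triangle.
Proof.
apply: continuous_Flag => i.
have [c1 c2 _] := sides_continuous R.
suff cn k : (k < 5)%N -> vcontinuous (fun x => flag_space x k) by exact: cn.
case: k => [|[|[|[|[|k]]]]] ltk.
- exact: vcontinuous_cst.
- exact: vertex12_continuous.
- exact: c1.
- exact: (vcontinuousD c1 c2 (fun x => dim_flag_space x (@Ordinal 5 3 isT))).
- exact: vcontinuous_cst.
- by exfalso; move: ltk.
Qed.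

(** * The orthogonal triangle of a flag *)

Section OfFlag.
Variable V : Flag R 4.

Definition flag_step (i : nat) (lti : (i < 5)%N) : {vspace 'rV[R]_4} :=
  val V (Ordinal lti).

Notation V1 := (@flag_step 1 isT).
Notation V2 := (@flag_step 2 isT).
Notation V3 := (@flag_step 3 isT).

Lemma dim_flag_step i (lti : (i < 5)%N) : \dim (flag_step lti) = i.
Proof. exact: eqP (valP (val V (Ordinal lti))). Qed.

Lemma flag_stepS i (lti : (i < 5)%N) (ltj : (i.+1 < 5)%N) :
  (flag_step lti <= flag_step ltj)%VS.
Proof. exact: (set_mem (valP V) (Ordinal lti) (Ordinal ltj) erefl). Qed.

(** The shear at parameter 1 is the orthogonal complement of one step in the next. *)
Lemma addv_flag_shear i (lti : (i < 5)%N) (ltj : (i.+1 < 5)%N) :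
  (flag_step lti + shear 1 (flag_step lti) (flag_step ltj))%VS = flag_step ltj.
Proof. by rewrite addv_shear (addv_idPr (flag_stepS _ _)). Qed.

(** Rank-nullity bounds the dimension above; the sum with the smaller step, of dimension [i.+1],
    bounds it below. *)
Lemma dim_flag_shear i (lti : (i < 5)%N) (ltj : (i.+1 < 5)%N) :
  \dim (shear 1 (flag_step lti) (flag_step ltj)) = 1.
Proof.
apply/eqP; rewrite eqn_leq; apply/andP; split.
  apply: leq_trans (dim_shear1 (flag_stepS _ _)) _.
  by rewrite !dim_flag_step subSnn.
have := dimv_sum_cap (flag_step lti) (shear 1 (flag_step lti) (flag_step ltj)).
rewrite addv_flag_shear !dim_flag_step; lia.
Qed.

Lemma flag_indep3 : indep3 V1 (shear 1 V1 V2) (shear 1 V2 V3).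
Proof.
split; rewrite ?dim_flag_shear ?dim_flag_step //.
by rewrite !addv_flag_shear dim_flag_step.
Qed.

End OfFlag.

Definition triangle_of_flag (V : Flag R 4) : spaceH R :=
  triangle (flag_indep3 V).

Lemma flag_step_continuous i (lti : (i < 5)%N) :
  vcontinuous (fun V : Flag R 4 => flag_step V lti).
Proof.
(* The factor of the product at this index has the ordinal itself as its dimension, which fixes the
   type of [step]. *)
pose step (V : Flag R 4) : Gr R (Ordinal lti) 4 := val V (Ordinal lti).
suff : continuous step by move/vcontinuous_Gr.
move=> V; apply: (@continuous_comp (Flag R 4)
  (prod_topology (fun i : 'I_5 => Gr R i 4)) (Gr R (Ordinal lti) 4)
  val (fun h => h (Ordinal lti))); first exact: initial_continuous.
exact: proj_continuous.
Qed.

Lemma flag_shear_continuous i (lti : (i < 5)%N) (ltj : (i.+1 < 5)%N) :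
  vcontinuous (fun V : Flag R 4 => shear 1 (flag_step V lti) (flag_step V ltj)).
Proof.
apply: (vcontinuous_shear (t := fun=> 1) (k := 1)).
- exact: cst_continuous.
- exact: flag_step_continuous.
- exact: flag_step_continuous.
- by move=> V; exact: dim_flag_shear.
Qed.

Lemma triangle_of_flag_continuous : continuous triangle_of_flag.
Proof.
apply: triangle_continuous.
- exact: flag_step_continuous.
- exact: flag_shear_continuous.
- exact: flag_shear_continuous.
Qed.

(** Adding the successive orthogonal complements rebuilds the flag, so this composite is exactly the
    identity. *)
Lemma flag_of_triangleK V : flag_of_triangle (triangle_of_flag V) = V.
Proof.
have ind := flag_indep3 V.
have s1 : side1 (triangle_of_flag V) =
    flag_step V (isT : 2 < 5)%N :> {vspace _}.
  exact: (@addv_flag_shear V 1 isT isT).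
have v12 : vertex12 (triangle_of_flag V) = flag_step V (isT : 1 < 5)%N.
  exact: cap_indep3 ind.
have v23 : vertex23 (triangle_of_flag V) =
    shear 1 (flag_step V (isT : 2 < 5)%N) (flag_step V (isT : 3 < 5)%N).
  (* Cyclically permuted, the independence puts the third vertex first, as the intersection of the
     second and third sides. *)
  rewrite -[RHS](cap_indep3 (indep3_213 (indep3_132 ind))).
  by rewrite /vertex23 /= addvC (addvC (shear _ _ _)).
apply/val_inj/functional_extensionality_dep => i; apply: val_inj.
have dimV : \dim (val V i) = i by exact: eqP (valP (val V i)).
change (flag_space (triangle_of_flag V) i = val V i).
case: i dimV => -[|[|[|[|[|//]]]]] lti dimV.
(* The extreme steps are determined by their dimensions; in the middle ones the ordinals differ only
   in the proof of their bound. *)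
- by apply/esym/eqP; rewrite -dimv_eq0 dimV.
- by rewrite /= v12 /flag_step; congr (Gr_vspace (val V _)); apply: val_inj.
- by rewrite /= s1 /flag_step; congr (Gr_vspace (val V _)); apply: val_inj.
- rewrite /= side1D2 v23 s1 (@addv_flag_shear V 2 isT isT) /flag_step.
  by congr (Gr_vspace (val V _)); apply: val_inj.
- by apply/esym/eqP; rewrite eqEdim subvf dimvf dim_matrix dimV.
Qed.

(** * The Gram-Schmidt deformation of a triangle *)

Section Deformation.
Variables (t : R) (x : spaceH R).

Definition vertex13_at := shear t (vertex12 x) (vertex13 x).
Definition vertex23_at := shear t (side1 x) (vertex23 x).

Lemma addv_vertex13_at : (vertex12 x + vertex13_at)%VS = side1 x.
Proof. by rewrite addv_shear; case: (verticesP x). Qed.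

(** For every real [t], the first two vertices still span [side1 x], and adding the third still
    gives the original plane. *)
Lemma indep3_at : indep3 (vertex12 x) vertex13_at vertex23_at.
Proof.
have [[d12 d13 d23 d] e _ _] := verticesP x.
split=> //; rewrite ?(leq_trans (dim_shear _ _ _)) //.
by rewrite addv_vertex13_at addv_shear -e.
Qed.

End Deformation.

(** Time is reversed by [1 - s.1] so that the homotopy starts at the composite through flags and
    ends at the identity. *)
Definition deform (s : R * spaceH R) : spaceH R :=
  triangle (indep3_at (1 - s.1) s.2).

Lemma deform_continuous : continuous deform.
Proof.
have cs2 W : vcontinuous W -> vcontinuous (fun s : R * spaceH R => W s.2).
  move=> cW s; apply: (@continuous_comp _ _ _ snd (fun x => orthproj (W x))).
    exact: cvg_snd.
  exact: cW.
have ct : continuous (fun s : R * spaceH R => 1 - s.1).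
  by move=> s; apply: cvgB; [exact: cvg_cst | exact: cvg_fst].
have [c1 _ _] := sides_continuous R.
apply: triangle_continuous; first exact: cs2 (@vertex12_continuous R).
- apply: vcontinuous_shear ct _ _ _.
  + exact: cs2 (@vertex12_continuous R).
  + exact: cs2 (@vertex13_continuous R).
  + by move=> s; exact: dim_indep3 (indep3_213 (indep3_at _ _)).
- apply: vcontinuous_shear ct _ _ _.
  + exact: cs2 c1.
  + exact: cs2 (@vertex23_continuous R).
  + by move=> s; exact: dim_indep3 (indep3_213 (indep3_132 (indep3_at _ _))).
Qed.

(** The flag construction shears whole steps, the deformation only the added vertices; at parameter
    1 the two agree because the smaller step is killed. *)
Lemma deform0 x : deform (0, x) = triangle_of_flag (flag_of_triangle x).
Proof.
have e : shear 1 (vertex12 x) (side1 x) = vertex13_at 1 x.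
  by have [_ <- _ _] := verticesP x; rewrite shear1_addl.
have e' : shear 1 (side1 x) (side1 x + side2 x)%VS = vertex23_at 1 x.
  by rewrite side1D2 shear1_addl.
have -> : deform (0, x) = triangle (indep3_at 1 x).
  by rewrite /deform subr0.
by apply: eq_triangle; [| exact: esym e | exact: esym e'].
Qed.

Lemma deform1 x : deform (1, x) = x.
Proof.
have [_ e1 e2 e3] := verticesP x.
have -> : deform (1, x) = triangle (indep3_at 0 x).
  by rewrite /deform subrr.
have e13 : vertex13_at 0 x = vertex13 x by exact: shear0.
have e23 : vertex23_at 0 x = vertex23 x by exact: shear0.
by apply: spaceH_eq;
  rewrite ?side1_triangle ?side2_triangle ?side3_triangle ?e13 ?e23.
Qed.

End Equivalence.

Theorem theorem3 (R : realType) : homotopy_equivalent R (spaceH R) (Flag R 4).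
Proof.
exists (@flag_of_triangle R), (@triangle_of_flag R); split.
- exact: flag_of_triangle_continuous.
- exact: triangle_of_flag_continuous.
- exists (@deform R); split=> [|x|x]; [|exact: deform0|exact: deform1].
  exact/continuous_subspaceT/deform_continuous.
(* The composite on flags equals the identity, so the constant homotopy serves. *)
- exists snd; split=> [|V|V] //; last by rewrite /= flag_of_triangleK.
  by apply: continuous_subspaceT => s; exact: cvg_snd.
Qed.
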